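(* The simple objects of $\mathbb{T}_W$ and $\mathbb{T}_W^{\leq}$ coincide.
   Context: The ground field is $\mathbb{C}$; $I=\{1,2,3,\dots\}$. $\mathfrak{gl}(\infty)$ is the Lie algebra of matrices $(a_{ij})_{i,j\in I}$ with finitely many nonzero entries, with matrix units $E_{i,j}$. A $\mathfrak{gl}(\infty)$-module $M$ is integrable if $\dim\operatorname{Span}\{x^i m\mid i>0\}<\infty$ for all $x\in\mathfrak{gl}(\infty)$, $m\in M$. $\Lambda(\infty)$ is the Grassmann algebra on odd generators $\xi_i$ ($i\in I$), $\mathbb{Z}$-graded by $\deg\xi_i=1$; $\partial_i$ is the odd superderivation with $\partial_i(\xi_j)=\delta_{ij}$. $\mathfrak{g}=W(\infty)=\varinjlim W(n)$ (where $W(n)$ is the Lie superalgebra of superderivations of the Grassmann algebra $\Lambda(n)$) is the Lie superalgebra spanned by the superderivations $P\partial_j$ of $\Lambda(\infty)$, $P\in\Lambda(\infty)$, $j\in I$. It is $\mathbb{Z}$-graded, $\mathfrak{g}=\bigoplus_{k\ge-1}\mathfrak{g}^k$, with $\mathfrak{g}^k=\operatorname{Span}\{P\partial_j\mid P\in\Lambda(\infty)^{k+1},\ j\in I\}$, and parity equal to degree mod $2$; $\mathfrak{g}^0$ is identified with $\mathfrak{gl}(\infty)$ via $\xi_i\partial_j\leftrightarrow E_{i,j}$. Put $\mathfrak{g}^{\leq}=\mathfrak{g}^{-1}\oplus\mathfrak{g}^0$. For $n\ge1$, $\mathfrak{t}_n\subset\mathfrak{g}$ is the subalgebra generated by all $\partial_j$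 and $\xi_{i_1}\cdots\xi_{i_k}\partial_j$ with $j,i_1,\dots,i_k\ge n$. $\mathbb{T}_W$ (resp. $\mathbb{T}_W^{\leq}$) is the full subcategory of $\mathfrak{g}$-modules $M$ such that: (1) $M$ has a $\mathbb{Z}$-grading $M=\bigoplus_{k\in\mathbb{Z}}M^k$ compatible with the superalgebra grading (i.e. $\mathfrak{g}^iM^j\subseteq M^{i+j}$ and the parity of $M^k$ is $k$ mod $2$); (2) $M$ is integrable over $\mathfrak{g}^0$; (3) for every $m\in M$ there is $n$ with $\mathfrak{t}_n\subseteq\operatorname{Ann}_{\mathfrak{g}}(m)$ (resp. $\mathfrak{t}_n\cap\mathfrak{g}^{\leq}\subseteq\operatorname{Ann}_{\mathfrak{g}}(m)$). *)

(* Defs.v *)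
From HB Require Import structures.
From mathcomp Require Import all_boot all_order all_algebra.
From mathcomp Require Import finmap.

Set Implicit Arguments.
Unset Strict Implicit.
Unset Printing Implicit Defensive.

Import GRing.Theory.
Local Open Scope fset_scope.
Local Open Scope ring_scope.

(* The index set {1, 2, ...} is encoded as nat by the shift i |-> i - 1. *)

(* The vector space with basis B.  Its operations are locked because failing  *)
(* unifications would otherwise unfold them down to finite maps.              *)
Definition free (K : fieldType) (B : choiceType) : Type :=
  {fsfun B -> K with 0}.
HB.instance Definition _ (K : fieldType) (B : choiceType) :=
  Choice.on (free K B).

HB.lock Definition coef (K : fieldType) (B : choiceType) (x : free K B) (b : B) : K :=
  x b.
HB.lock Definition supp (K : fieldType) (B : choiceType) (x : free K B) : {fset B} :=
  finsupp x.
HB.lock Definition basis (K : fieldType) (B : choiceType) (b : B) : free K B :=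
  [fsfun c in [fset b] => (c == b)%:R].
HB.lock Definition free_zero (K : fieldType) (B : choiceType) : free K B :=
  [fsfun].
HB.lock Definition free_opp (K : fieldType) (B : choiceType) (x : free K B) : free K B :=
  [fsfun b in finsupp x => - x b].
HB.lock Definition free_add (K : fieldType) (B : choiceType) (x y : free K B) : free K B :=
  [fsfun b in finsupp x `|` finsupp y => x b + y b].
HB.lock Definition free_scale (K : fieldType) (B : choiceType) (a : K) (x : free K B) : free K B :=
  [fsfun b in finsupp x => a * x b].

Section FreeModule.
Variables (K : fieldType) (B : choiceType).
Implicit Types (x y : free K B) (b : B).

Lemma freeP x y : (forall b, coef x b = coef y b) -> x = y.
Proof. by rewrite coef.unlock => h; apply/fsfunP. Qed.

Lemma mem_supp x b : (b \in supp x) = (coef x b != 0).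
Proof. by rewrite coef.unlock supp.unlock mem_finsupp. Qed.

Lemma coef_out x b : b \notin supp x -> coef x b = 0.
Proof. by rewrite mem_supp negbK => /eqP. Qed.

Lemma coef_basis b c : coef (basis K b) c = (c == b)%:R.
Proof. by rewrite coef.unlock basis.unlock fsfunE in_fset1; case: eqP. Qed.

Lemma coef_zero b : coef (free_zero K B) b = 0.
Proof. by rewrite coef.unlock free_zero.unlock fsfunE. Qed.

Lemma coef_opp x b : coef (free_opp x) b = - coef x b.
Proof.
rewrite coef.unlock free_opp.unlock fsfunE; case: finsuppP => // _.
by rewrite oppr0.
Qed.

Lemma coef_add x y b : coef (free_add x y) b = coef x b + coef y b.
Proof.
rewrite coef.unlock free_add.unlock fsfunE in_fsetU.
by case: finsuppP => _ //=; case: finsuppP => _ //=; rewrite add0r.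
Qed.

Lemma coef_scale a x b : coef (free_scale a x) b = a * coef x b.
Proof.
rewrite coef.unlock free_scale.unlock fsfunE; case: finsuppP => // _.
by rewrite mulr0.
Qed.

Lemma free_addA : associative (@free_add K B).
Proof. by move=> x y z; apply: freeP => b; rewrite !coef_add addrA. Qed.
Lemma free_addC : commutative (@free_add K B).
Proof. by move=> x y; apply: freeP => b; rewrite !coef_add addrC. Qed.
Lemma free_add0 : left_id (free_zero K B) (@free_add K B).
Proof. by move=> x; apply: freeP => b; rewrite coef_add coef_zero add0r. Qed.
Lemma free_addN : left_inverse (free_zero K B) (@free_opp K B) (@free_add K B).
Proof.
by move=> x; apply: freeP => b; rewrite coef_add coef_opp coef_zero addNr.
Qed.

HB.instance Definition _ := GRing.isZmodule.Build (free K B)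
  free_addA free_addC free_add0 free_addN.

Lemma coef0 b : coef (0 : free K B) b = 0. Proof. exact: coef_zero. Qed.
Lemma coefN x b : coef (- x) b = - coef x b. Proof. exact: coef_opp. Qed.
Lemma coefD x y b : coef (x + y) b = coef x b + coef y b.
Proof. exact: coef_add. Qed.

Lemma free_scaleA a c x : free_scale a (free_scale c x) = free_scale (a * c) x.
Proof. by apply: freeP => b; rewrite !coef_scale mulrA. Qed.
Lemma free_scale1 : left_id 1 (@free_scale K B).
Proof. by move=> x; apply: freeP => b; rewrite coef_scale mul1r. Qed.
Lemma free_scaleDr : right_distributive (@free_scale K B) +%R.
Proof.
by move=> a x y; apply: freeP => b; rewrite !(coef_scale, coefD) mulrDr.
Qed.
Lemma free_scaleDl x : {morph (@free_scale K B)^~ x : a c / a + c}.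
Proof.
by move=> a c /=; apply: freeP => b; rewrite !(coef_scale, coefD) mulrDl.
Qed.

HB.instance Definition _ := GRing.Zmodule_isLmodule.Build K (free K B)
  free_scaleA free_scale1 free_scaleDr free_scaleDl.

Lemma coefZ a x b : coef (a *: x) b = a * coef x b.
Proof. exact: coef_scale. Qed.

Lemma coef_sum (I : Type) (r : seq I) (F : I -> free K B) b :
  coef (\sum_(i <- r) F i) b = \sum_(i <- r) coef (F i) b.
Proof.
by elim/big_rec2: _ => [|i y1 y2 _ <-]; rewrite ?coef0 ?coefD.
Qed.

Lemma free_sumE x : x = \sum_(b <- supp x) coef x b *: basis K b.
Proof.
apply: freeP => c; rewrite coef_sum.
rewrite (eq_bigr (fun b => coef x b * (c == b)%:R)); last first.
  by move=> b _; rewrite coefZ coef_basis.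
case: (boolP (c \in supp x)) => cx; last first.
  rewrite coef_out // big_seq big1 // => b bx.
  by case: eqP => [cb|]; rewrite ?mulr0 //; rewrite cb bx in cx.
rewrite (big_fsetD1 c) //= eqxx mulr1 big_seq big1 ?addr0 // => b.
by rewrite in_fsetD1 eq_sym => /andP[/negPf-> _]; rewrite mulr0.
Qed.

Lemma free_indS (P : free K B -> Prop) x :
  P 0 -> (forall a u v, P u -> P v -> P (a *: u + v)) ->
  (forall b, b \in supp x -> P (basis K b)) -> P x.
Proof.
move=> P0 PD Pb; rewrite (free_sumE x) big_seq.
by elim/big_rec: _ => [|b u bx Pu]; [exact: P0 | exact: PD (Pb b bx) Pu].
Qed.

Lemma free_ind (P : free K B -> Prop) :
  P 0 -> (forall a u v, P u -> P v -> P (a *: u + v)) ->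
  (forall b, P (basis K b)) -> forall x, P x.
Proof. by move=> P0 PD Pb x; apply: free_indS. Qed.

Definition homog (T : Type) (d : B -> T) (t : T) x : Prop :=
  forall b, b \in supp x -> d b = t.

End FreeModule.

HB.lock Definition lext (K : fieldType) (B : choiceType) (V : lmodType K)
    (f : B -> V) (x : free K B) : V :=
  \sum_(b <- supp x) coef x b *: f b.

Section LinearExtension.
Variables (K : fieldType) (B : choiceType).
Variable V : lmodType K.
Implicit Type f : B -> V.

Lemma lextEw (d : {fset B}) f (x : free K B) : supp x `<=` d ->
  lext f x = \sum_(b <- d) coef x b *: f b.
Proof.
move=> xd; rewrite lext.unlock; apply: big_fset_incl => // b _ bx.
by rewrite coef_out // scale0r.
Qed.

Lemma lext_is_linear f : linear (lext f).
Proof.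
move=> a u v; set w := a *: u + v; set d := supp u `|` supp v `|` supp w.
have ud : supp u `<=` d by rewrite /d -fsetUA fsubsetUl.
have vd : supp v `<=` d by rewrite /d -fsetUA fsetUCA fsubsetUl.
have wd : supp w `<=` d by rewrite /d fsubsetUr.
rewrite !(@lextEw d) // scaler_sumr -big_split /=; apply: eq_bigr => b _.
by rewrite coefD coefZ scalerDl scalerA.
Qed.

HB.instance Definition _ f :=
  GRing.isLinear.Build K (free K B) V *:%R (lext f) (lext_is_linear f).

Lemma lextU f b : lext f (basis K b) = f b.
Proof.
rewrite (@lextEw [fset b]) ?big_seq_fset1 ?coef_basis ?eqxx ?scale1r //.
apply/fsubsetP => c; rewrite mem_supp coef_basis in_fset1.
by case: (c == b); rewrite ?eqxx.
Qed.

End LinearExtension.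

(* basis K A is the monomial xi_{a_1} ... xi_{a_k}, A = {a_1 < ... < a_k}. *)
Definition Lambda (K : fieldType) : Type := free K {fset nat}.

HB.instance Definition _ (K : fieldType) := GRing.Lmodule.on (Lambda K).

(* xi_A xi_B = (-1)^(inversions A B) xi_(A u B) for A and B disjoint. *)
Definition inversions (A B : {fset nat}) : nat :=
  (\sum_(a <- A) \sum_(b <- B) (b < a))%N.
Definition sgn (A B : {fset nat}) : bool := odd (inversions A B).

Section Signs.
Implicit Types (A B C : {fset nat}) (i j : nat).

Lemma big_fsetU_disj A B (F : nat -> nat) : [disjoint A & B]%fset ->
  (\sum_(i <- A `|` B) F i = \sum_(i <- A) F i + \sum_(i <- B) F i)%N.
Proof.
move=> dAB; rewrite -big_cat /=; apply: perm_big; apply: uniq_perm.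
- exact: fset_uniq.
- rewrite cat_uniq !fset_uniq andbT /=; apply/hasPn => i iB /=.
  by apply/negP => iA; move/fdisjointP: dAB => /(_ i iA); rewrite iB.
- by move=> i; rewrite mem_cat in_fsetU.
Qed.

Lemma sgnUl A B C : [disjoint A & B]%fset ->
  sgn (A `|` B) C = sgn A C (+) sgn B C.
Proof. by move=> d; rewrite /sgn /inversions big_fsetU_disj // oddD. Qed.

Lemma sgnUr A B C : [disjoint B & C]%fset ->
  sgn A (B `|` C) = sgn A B (+) sgn A C.
Proof.
move=> d; rewrite /sgn /inversions -oddD -big_split /=; congr odd.
by apply: eq_bigr => a _; rewrite big_fsetU_disj.
Qed.

Lemma sgn11 i j : sgn [fset i] [fset j] = (j < i)%N.
Proof. by rewrite /sgn /inversions !big_seq_fset1 oddb. Qed.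

Lemma sgn0l A : sgn fset0 A = false.
Proof. by rewrite /sgn /inversions big_seq_fset0. Qed.

Lemma sgn0r A : sgn A fset0 = false.
Proof.
by rewrite /sgn /inversions big1 // => a _; rewrite big_seq_fset0.
Qed.

Lemma sgn1D1l i j A : j \in A -> sgn A [fset i] = (i < j)%N (+) sgn (A `\ j) [fset i].
Proof.
move=> jA; rewrite -{1}(fsetD1K jA) sgnUl ?sgn11 //.
by rewrite fdisjoint1X !inE eqxx.
Qed.

Lemma sgnD1l j A B : j \in A -> sgn A B = sgn [fset j] B (+) sgn (A `\ j) B.
Proof.
by move=> jA; rewrite -{1}(fsetD1K jA) sgnUl // fdisjoint1X !inE eqxx.
Qed.

Lemma sgnD1r j A B : j \in B -> sgn A B = sgn A [fset j] (+) sgn A (B `\ j).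
Proof.
by move=> jB; rewrite -{1}(fsetD1K jB) sgnUr // fdisjoint1X !inE eqxx.
Qed.

Lemma sgnC A B : [disjoint A & B]%fset ->
  sgn A B (+) sgn B A = odd #|` A| && odd #|` B|.
Proof.
move=> dAB; rewrite /sgn /inversions -oddD -oddM; congr odd.
rewrite [X in (_ + X)%N]exchange_big /= -big_split /=.
rewrite card_fset_sum1 big_distrl /= big_seq [RHS]big_seq.
apply: eq_bigr => a aA; rewrite mul1n card_fset_sum1 -big_split /= big_seq.
rewrite [RHS]big_seq; apply: eq_bigr => b bB.
have : a != b.
  by apply/eqP => ab; move/fdisjointP: dAB => /(_ a aA); rewrite ab bB.
by case: ltngtP.
Qed.

Lemma sgn1C j A : j \notin A -> sgn [fset j] A (+) sgn A [fset j] = odd #|` A|.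
Proof. by move=> jA; rewrite sgnC ?fdisjoint1X // cardfs1. Qed.

End Signs.

Definition mulmono (K : fieldType) (A B : {fset nat}) : Lambda K :=
  if [disjoint A & B]%fset then (-1) ^+ sgn A B *: basis K (A `|` B) else 0.

HB.lock Definition Lambda_mul (K : fieldType) (u v : Lambda K) : Lambda K :=
  lext (fun A => lext (mulmono K A) v) u.

Section Grassmann.
Variable K : fieldType.
Local Notation mulmono := (mulmono K).
Local Notation Lambda_mul := (@Lambda_mul K).
Implicit Types (A B C : {fset nat}) (i j : nat).

Local Notation mono A := (basis K A : Lambda K).

Lemma Lambda_indS (P : Lambda K -> Prop) (u : Lambda K) :
  P 0 -> (forall a v w, P v -> P w -> P (a *: v + w)) ->
  (forall A, A \in supp u -> P (mono A)) -> P u.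
Proof. exact: free_indS. Qed.

Lemma Lambda_ind (P : Lambda K -> Prop) :
  P 0 -> (forall a v w, P v -> P w -> P (a *: v + w)) ->
  (forall A, P (mono A)) -> forall u, P u.
Proof. exact: free_ind. Qed.

Lemma Lambda_mulUU A B : Lambda_mul (mono A) (mono B) = mulmono A B.
Proof. by rewrite Lambda_mul.unlock !lextU. Qed.

Lemma Lambda_mulPl v a u w :
  Lambda_mul (a *: u + w) v = a *: Lambda_mul u v + Lambda_mul w v.
Proof. by rewrite Lambda_mul.unlock; exact: linearP. Qed.

Lemma Lambda_mulPr u a v w :
  Lambda_mul u (a *: v + w) = a *: Lambda_mul u v + Lambda_mul u w.
Proof.
have mul0l x : Lambda_mul 0 x = 0.
  by rewrite Lambda_mul.unlock; exact: linear0.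
have mulUl A x : Lambda_mul (mono A) x = lext (mulmono A) x.
  by rewrite Lambda_mul.unlock lextU.
elim/Lambda_ind: u => [|b u1 u2 h1 h2|A].
- by rewrite !mul0l scaler0 addr0.
- rewrite !Lambda_mulPl h1 h2 !scalerDr !scalerA.
  by rewrite (mulrC b a); exact: addrACA.
- by rewrite !mulUl; exact: linearP.
Qed.

Lemma Lambda_mul0l v : Lambda_mul 0 v = 0.
Proof. by rewrite Lambda_mul.unlock; exact: linear0. Qed.

Lemma Lambda_mul0r u : Lambda_mul u 0 = 0.
Proof. by have := Lambda_mulPr u (-1) 0 0; rewrite !scaler0 addr0 scaleN1r addNr. Qed.

Lemma Lambda_mulZl a u v : Lambda_mul (a *: u) v = a *: Lambda_mul u v.
Proof. by rewrite -[a *: u]addr0 Lambda_mulPl Lambda_mul0l addr0. Qed.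

Lemma Lambda_mulZr a u v : Lambda_mul u (a *: v) = a *: Lambda_mul u v.
Proof. by rewrite -[a *: v]addr0 Lambda_mulPr Lambda_mul0r addr0. Qed.

Lemma Lambda_mulA : associative Lambda_mul.
Proof.
move=> u v w; elim/Lambda_ind: u; first by rewrite !Lambda_mul0l.
  by move=> a u1 u2 h1 h2; rewrite !Lambda_mulPl h1 h2.
move=> A; elim/Lambda_ind: v; first by rewrite Lambda_mul0r !Lambda_mul0l Lambda_mul0r.
  by move=> a u1 u2 h1 h2; rewrite !(Lambda_mulPl, Lambda_mulPr) h1 h2.
move=> B; elim/Lambda_ind: w; first by rewrite !Lambda_mul0r.
  by move=> a u1 u2 h1 h2; rewrite !Lambda_mulPr h1 h2.
move=> C; rewrite !Lambda_mulUU /mulmono.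
case: ifP => dBC; case: ifP => dAB; rewrite ?Lambda_mul0l ?Lambda_mul0r //.
- rewrite Lambda_mulZl Lambda_mulZr !Lambda_mulUU /mulmono.
  rewrite fdisjointXU fdisjointUX dAB dBC /= andbT; case: ifP => dAC; last first.
    by rewrite !scaler0.
  rewrite !scalerA -!signr_addb sgnUl // sgnUr // fsetUA; congr (_ ^+ _ *: _).
  by case: (sgn A B) (sgn A C) (sgn B C) => [] [] [].
- by rewrite Lambda_mulZr Lambda_mulUU /mulmono fdisjointXU dAB scaler0.
- by rewrite Lambda_mulZl Lambda_mulUU /mulmono fdisjointUX dBC andbF scaler0.
Qed.

Lemma Lambda_mul1l : left_id (mono fset0) Lambda_mul.
Proof.
move=> u; elim/Lambda_ind: u; first by rewrite !Lambda_mul0r.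
  by move=> a u1 u2 h1 h2; rewrite Lambda_mulPr h1 h2.
move=> A; rewrite Lambda_mulUU /mulmono.
by rewrite fdisjoint0X sgn0l fset0U expr0 scale1r.
Qed.

Lemma Lambda_mul1r : right_id (mono fset0) Lambda_mul.
Proof.
move=> u; elim/Lambda_ind: u; first by rewrite !Lambda_mul0l.
  by move=> a u1 u2 h1 h2; rewrite Lambda_mulPl h1 h2.
move=> A; rewrite Lambda_mulUU /mulmono.
by rewrite fdisjointX0 sgn0r fsetU0 expr0 scale1r.
Qed.

Lemma Lambda_mulDl : left_distributive Lambda_mul +%R.
Proof. by move=> u v w; have := Lambda_mulPl w 1 u v; rewrite !scale1r. Qed.

Lemma Lambda_mulDr : right_distributive Lambda_mul +%R.
Proof. by move=> w u v; have := Lambda_mulPr w 1 u v; rewrite !scale1r. Qed.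

Lemma Lambda_1_neq0 : mono fset0 != 0 :> Lambda K.
Proof.
apply/eqP => /(congr1 (fun u : free K _ => coef u fset0)) /eqP.
by rewrite coef_basis coef0 eqxx oner_eq0.
Qed.

HB.instance Definition _ := GRing.Zmodule_isNzRing.Build (Lambda K)
  Lambda_mulA Lambda_mul1l Lambda_mul1r Lambda_mulDl Lambda_mulDr Lambda_1_neq0.

Lemma Lambda_scalerAl (a : K) (u v : Lambda K) : a *: (u * v) = (a *: u) * v.
Proof. by rewrite -[LHS]/(a *: Lambda_mul u v) -Lambda_mulZl. Qed.

HB.instance Definition _ :=
  GRing.Lmodule_isLalgebra.Build K (Lambda K) Lambda_scalerAl.

Lemma Lambda_scalerAr (a : K) (u v : Lambda K) : a *: (u * v) = u * (a *: v).
Proof. by rewrite -[LHS]/(a *: Lambda_mul u v) -Lambda_mulZr. Qed.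

HB.instance Definition _ :=
  GRing.Lalgebra_isAlgebra.Build K (Lambda K) Lambda_scalerAr.

Definition xi i : Lambda K := basis K [fset i].

Definition Lambda_deg (k : nat) (u : Lambda K) : Prop :=
  homog (fun A => #|` A|) k u.
Definition Lambda_par (p : bool) (u : Lambda K) : Prop :=
  homog (fun A => odd #|` A|) p u.

(* xi_A = (-1)^s xi_j xi_(A \ j) for j in A, with s the number of elements of *)
(* A below j, i.e. the inversions of the word j A.                            *)
Definition partial j : Lambda K -> Lambda K :=
  lext (fun A => if j \in A then (-1) ^+ sgn [fset j] A *: mono (A `\ j) else 0).

HB.instance Definition _ j := GRing.Linear.on (partial j).

Lemma partialP j a u v : partial j (a *: u + v) = a *: partial j u + partial j v.
Proof. exact: linearP. Qed.

Lemma partial0 j : partial j 0 = 0.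
Proof. exact: linear0. Qed.

Lemma partialZ j a u : partial j (a *: u) = a *: partial j u.
Proof. exact: linearZ. Qed.

Lemma mulUU A B : mono A * mono B = mulmono A B.
Proof. exact: Lambda_mulUU. Qed.

Lemma partialU j A :
  partial j (mono A) = if j \in A then (-1) ^+ sgn [fset j] A *: mono (A `\ j) else 0.
Proof. exact: lextU. Qed.

Lemma partial_xi i j : partial i (xi j) = (i == j)%:R.
Proof.
rewrite partialU in_fset1; case: eqP => // ->.
by rewrite sgn11 ltnn expr0 scale1r fsetDv.
Qed.

Lemma signZZ (b c : bool) (u : Lambda K) :
  (-1) ^+ b *: ((-1) ^+ c *: u) = (-1) ^+ (b (+) c) *: u.
Proof. by rewrite scalerA -signr_addb. Qed.

Lemma partialMU j A B :
  partial j (mono A * mono B) =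
    partial j (mono A) * mono B + (-1) ^+ odd #|` A| *: (mono A * partial j (mono B)).
Proof.
rewrite mulUU /mulmono !partialU; case: (boolP [disjoint A & B]%fset) => dAB.
  have /fdisjointP AB := dAB.
  rewrite [LHS]linearZ /= partialU in_fsetU.
  case: (boolP (j \in A)) => jA.
    have jB : j \notin B by exact: AB.
    have dAB' : [disjoint A `\ j & B]%fset.
      by apply/fdisjointP => i; rewrite in_fsetD1 => /andP[_]; exact: AB.
    rewrite (negPf jB) mulr0 scaler0 addr0 /= -scalerAl mulUU /mulmono dAB'.
    rewrite !signZZ sgnUr // (sgnD1l _ jA) fsetDUl (mem_fsetD1 jB).
    congr (_ ^+ _ *: _).
    by case: (sgn _ B) (sgn _ A) (sgn (_ `\ _) B) => [] [] [].
  rewrite mul0r add0r /=; case: (boolP (j \in B)) => jB; last by rewrite mulr0 !scaler0.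
  have dAB' : [disjoint A & B `\ j]%fset.
    by apply/fdisjointP => i /AB; rewrite in_fsetD1 negb_and => ->; rewrite orbT.
  rewrite -scalerAr mulUU /mulmono dAB' !signZZ sgnUr // (sgnD1r _ jB) fsetDUl.
  rewrite (mem_fsetD1 jA) -(sgn1C jA); congr (_ ^+ _ *: _).
  by case: (sgn A _) (sgn A (_ `\ _)) (sgn _ A) (sgn _ B) => [] [] [] [].
rewrite linear0.
case: (boolP (j \in A)) => jA; last first.
  rewrite mul0r add0r; case: (boolP (j \in B)) => jB; last by rewrite mulr0 scaler0.
  rewrite -scalerAr mulUU /mulmono (_ : [disjoint A & B `\ j]%fset = false) ?scaler0 //.
  apply/negbTE; apply: contraNN dAB => /fdisjointP d; apply/fdisjointP => i iA.
  have := d i iA; rewrite in_fsetD1 negb_and negbK => /orP[/eqP ij|//].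
  by rewrite ij (negPf jA) in iA.
case: (boolP (j \in B)) => jB; last first.
  rewrite mulr0 scaler0 addr0 -scalerAl mulUU /mulmono.
  rewrite (_ : [disjoint A `\ j & B]%fset = false) ?scaler0 //.
  apply/negbTE; apply: contraNN dAB => /fdisjointP d; apply/fdisjointP => i iA.
  by case: (eqVneq i j) => [->//|ij]; apply: d; rewrite in_fsetD1 ij.
rewrite -scalerAl -scalerAr !mulUU /mulmono.
have -> : [disjoint A `\ j & B]%fset = [disjoint A & B `\ j]%fset.
  apply/fdisjointP/fdisjointP => d i.
    move=> iA; rewrite in_fsetD1 negb_and negbK; case: (eqVneq i j) => //= ij.
    by apply: d; rewrite in_fsetD1 ij.
  rewrite in_fsetD1 => /andP[ij iA]; have := d i iA.
  by rewrite in_fsetD1 negb_and negbK (negPf ij).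
case: ifP => _; last by rewrite !scaler0 addr0.
have -> : A `\ j `|` B = A `|` B.
  by apply/fsetP => i; rewrite !inE; case: eqP => [->|] //=; rewrite jB !orbT.
have -> : A `|` B `\ j = A `|` B.
  by apply/fsetP => i; rewrite !inE; case: eqP => [->|] //=; rewrite jA.
rewrite !signZZ -scalerDl.
have jA' : j \notin A `\ j by rewrite !inE eqxx.
have cA : odd #|` A| = ~~ odd #|` A `\ j| by rewrite (cardfsD1 j A) jA.
rewrite cA -(sgn1C jA') (sgnD1r (A `\ j) jB) (sgnD1l (B `\ j) jA).
rewrite (sgnD1r [fset j] jA) (sgnD1r [fset j] jB) sgn11 ltnn /=.
set a := sgn _ (A `\ j); set b := sgn (A `\ j) _; set c := sgn (A `\ j) _.
set d := sgn _ (B `\ j).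
by case: a b c d => [] [] [] []; rewrite /= ?expr0 ?expr1 ?subrr ?addNr scale0r.
Qed.

Lemma partialM j p u v : Lambda_par p u ->
  partial j (u * v) = partial j u * v + (-1) ^+ p *: (u * partial j v).
Proof.
rewrite /Lambda_par /homog => hu.
apply: (@Lambda_indS (fun u => partial j (u * v) =
  partial j u * v + (-1) ^+ p *: (u * partial j v)) u).
- by rewrite !(partial0, mul0r) ?scaler0 addr0.
- move=> a u1 u2 h1 h2; rewrite mulrDl -scalerAl !partialP h1 h2 !mulrDl -!scalerAl.
  by rewrite !scalerDr !scalerA (mulrC a) addrACA.
move=> A /hu <-; elim/Lambda_ind: v.
- by rewrite !(partial0, mulr0) ?scaler0 addr0.
- move=> a u1 u2 h1 h2; rewrite !mulrDr -!scalerAr !partialP h1 h2 !mulrDr -!scalerAr.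
  by rewrite !scalerDr !scalerA (mulrC a) addrACA.
- by move=> B; exact: partialMU.
Qed.

Lemma Lambda_mulC p q u v : Lambda_par p u -> Lambda_par q v ->
  u * v = (-1) ^+ (p && q) *: (v * u).
Proof.
rewrite /Lambda_par /homog => hu hv.
apply: (@Lambda_indS (fun u => u * v = (-1) ^+ (p && q) *: (v * u)) u).
- by rewrite mul0r mulr0 scaler0.
- move=> a u1 u2 h1 h2; rewrite mulrDl mulrDr -scalerAl -scalerAr h1 h2.
  by rewrite scalerDr !scalerA (mulrC a).
move=> A /hu <-.
apply: (@Lambda_indS (fun v => mono A * v = (-1) ^+ (odd #|` A| && q) *: (v * mono A)) v).
- by rewrite mul0r mulr0 scaler0.
- move=> a u1 u2 h1 h2; rewrite mulrDl mulrDr -scalerAl -scalerAr h1 h2.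
  by rewrite scalerDr !scalerA (mulrC a).
move=> B /hv <-; rewrite !mulUU /mulmono fdisjoint_sym; case: ifP => [dBA|]; last first.
  by rewrite scaler0.
rewrite signZZ fsetUC -sgnC 1?fdisjoint_sym //; congr (_ ^+ _ *: _).
by case: (sgn A B) (sgn B A) => [] [].
Qed.

Lemma partialC i j u : partial i (partial j u) = - partial j (partial i u).
Proof.
elim/Lambda_ind: u; first by rewrite !partial0 oppr0.
  by move=> a u1 u2 h1 h2; rewrite !partialP h1 h2 scalerN opprD.
move=> A; rewrite !partialU.
case: ifP => jA; case: ifP => iA; rewrite ?partialZ ?partial0 ?oppr0 ?partialU;
  rewrite ?in_fsetD1 ?iA ?jA ?andbF ?andbT ?scaler0 ?oppr0 //.
rewrite (eq_sym j i); case: (eqVneq i j) => [->|ij]; first by rewrite !scaler0 oppr0.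
have -> : A `\ j `\ i = A `\ i `\ j by rewrite !fsetDDl fsetUC.
rewrite !signZZ -scaleNr -signrN (sgnD1r [fset j] iA) (sgnD1r [fset i] jA) !sgn11.
congr (_ ^+ _ *: _); move: ij; case: ltngtP => // _ _.
  by case: (sgn [fset j] _) (sgn [fset i] _) => [] [].
by case: (sgn [fset j] _) (sgn [fset i] _) => [] [].
Qed.

End Grassmann.

(* The free Lambda K-module on the partial_j: basis K (A, j) is xi_A partial_j. *)
(* An element x acts on Lambda K as the superderivation der x.                 *)
Definition W (K : fieldType) : Type := free K ({fset nat} * nat)%type.

HB.instance Definition _ (K : fieldType) := GRing.Lmodule.on (W K).

Section W.
Variable K : fieldType.
Implicit Types (x y z : W K) (u v : Lambda K) (i j : nat).

Definition W_deg (k : int) (x : W K) : Prop :=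
  homog (fun b : {fset nat} * nat => (#|` b.1|)%:Z - 1) k x.
Definition W_par (p : bool) (x : W K) : Prop :=
  homog (fun b : {fset nat} * nat => ~~ odd #|` b.1|) p x.

Definition Wd (P : Lambda K) (j : nat) : W K :=
  lext (fun A => basis K (A, j) : W K) P.

Definition der (x : W K) (u : Lambda K) : Lambda K :=
  lext (fun b : {fset nat} * nat => (basis K b.1 : Lambda K) * partial b.2 u) x.

(* [P partial_i, Q partial_j] = P partial_i(Q) partial_j                     *)
(*   - (-1)^(|P partial_i| |Q partial_j|) Q partial_j(P) partial_i.          *)
Definition bracket_basis (c d : {fset nat} * nat) : W K :=
  Wd ((basis K c.1 : Lambda K) * partial c.2 (basis K d.1)) d.2
  - (-1) ^+ (~~ odd #|` c.1| && ~~ odd #|` d.1|)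
    *: Wd ((basis K d.1 : Lambda K) * partial d.2 (basis K c.1)) c.2.

Definition bracket (x y : W K) : W K :=
  lext (fun c => lext (bracket_basis c) y) x.

Lemma W_indS (P : W K -> Prop) (x : W K) :
  P 0 -> (forall a y z, P y -> P z -> P (a *: y + z)) ->
  (forall b, b \in supp x -> P (basis K b)) -> P x.
Proof. exact: free_indS. Qed.

Lemma WdP j a P Q : Wd (a *: P + Q) j = a *: Wd P j + Wd Q j.
Proof. exact: linearP. Qed.

Lemma derP u a x y : der (a *: x + y) u = a *: der x u + der y u.
Proof. exact: linearP. Qed.

Lemma der0 u : der 0 u = 0.
Proof. exact: linear0. Qed.

Lemma derU b u : der (basis K b) u = (basis K b.1 : Lambda K) * partial b.2 u.
Proof. exact: lextU. Qed.

Lemma der_linear x : linear (der x).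
Proof.
move=> a u v.
apply: (@W_indS (fun x => der x (a *: u + v) = a *: der x u + der x v) x).
- by rewrite !der0 scaler0 addr0.
- move=> c x1 x2 h1 h2; rewrite !derP h1 h2 !scalerDr !scalerA (mulrC a).
  exact: addrACA.
- by move=> b _; rewrite !derU partialP mulrDr -scalerAr.
Qed.

Lemma der_Wd P j u : der (Wd P j) u = P * partial j u.
Proof.
elim/Lambda_ind: P.
- by rewrite mul0r -[RHS](der0 u); congr der; exact: linear0.
- by move=> a v w h1 h2; rewrite WdP derP h1 h2 mulrDl -scalerAl.
- by move=> A; rewrite /Wd lextU derU.
Qed.

Lemma coef_der_xi x A j : coef (der x (xi K j)) A = coef x (A, j).
Proof.
apply: (@W_indS (fun x => coef (der x (xi K j)) A = coef x (A, j)) x).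
- by rewrite der0 !coef0.
- by move=> a x1 x2 h1 h2; rewrite derP !coefD !coefZ h1 h2.
move=> [B i] _; rewrite derU partial_xi mulr_natr coef_basis xpair_eqE.
rewrite /= (eq_sym j i); case: (i == j); rewrite ?mulr1n ?mulr0n ?andbT ?andbF.
  by rewrite coef_basis.
by rewrite coef0.
Qed.

(* W K is thus a space of superderivations of Lambda K, ... *)
Lemma der_inj x y : der x =1 der y -> x = y.
Proof.
by move=> xy; apply: freeP => -[A j]; rewrite -!coef_der_xi xy.
Qed.

Lemma Lambda_par_basis (A : {fset nat}) :
  Lambda_par (odd #|` A|) (basis K A : Lambda K).
Proof.
by move=> B; rewrite mem_supp coef_basis; case: (eqVneq B A) => [->//|_]; rewrite eqxx.
Qed.

Lemma der_superderivation p q x u v : W_par p x -> Lambda_par q u ->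
  der x (u * v) = der x u * v + (-1) ^+ (p && q) *: (u * der x v).
Proof.
move=> hx hu.
apply: (@W_indS (fun x => der x (u * v) =
  der x u * v + (-1) ^+ (p && q) *: (u * der x v)) x).
- by rewrite !der0 mul0r mulr0 scaler0 addr0.
- move=> a x1 x2 h1 h2; rewrite !derP h1 h2 mulrDl mulrDr -scalerAl -scalerAr.
  by rewrite !scalerDr !scalerA (mulrC a) addrACA.
move=> b /hx <-; rewrite !derU (partialM _ _ hu) mulrDr mulrA; congr (_ + _).
rewrite -scalerAr !mulrA (Lambda_mulC (@Lambda_par_basis b.1) hu) -scalerAl signZZ.
by congr (_ ^+ _ *: _); case: q {hu} (odd _) => [] [].
Qed.

(* ... and its bracket is the supercommutator. *)
Lemma der_bracket p q x y u : W_par p x -> W_par q y ->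
  der (bracket x y) u = der x (der y u) - (-1) ^+ (p && q) *: der y (der x u).
Proof.
move=> hx hy.
have derl z := der_linear z.
have derx0 z : der z 0 = 0.
  by have := derl z (-1) 0 0; rewrite scaler0 addr0 scaleN1r addNr.
apply: (@W_indS (fun x => der (bracket x y) u =
  der x (der y u) - (-1) ^+ (p && q) *: der y (der x u)) x).
- rewrite (_ : bracket 0 y = 0); last by exact: linear0.
  by rewrite !der0 derx0 scaler0 subr0.
- move=> a x1 x2 h1 h2.
  rewrite (_ : bracket _ y = a *: bracket x1 y + bracket x2 y); last exact: linearP.
  rewrite !derP h1 h2 derl !scalerDr !scalerN !scalerA opprD (mulrC a).
  exact: addrACA.
move=> c /hx <-.
rewrite (_ : bracket (basis K c) y = lext (bracket_basis c) y); last exact: lextU.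
apply: (@W_indS (fun y => der (lext (bracket_basis c) y) u =
  der (basis K c) (der y u) - (-1) ^+ (~~ odd #|` c.1| && q) *: der y (der (basis K c) u)) y).
- rewrite (_ : lext (bracket_basis c) 0 = 0); last by exact: linear0.
  by rewrite !der0 derx0 scaler0 subr0.
- move=> a x1 x2 h1 h2.
  rewrite (_ : lext (bracket_basis c) _ =
    a *: lext (bracket_basis c) x1 + lext (bracket_basis c) x2); last exact: linearP.
  rewrite !derP h1 h2 derl !scalerDr !scalerN !scalerA opprD (mulrC a).
  exact: addrACA.
move=> d /hy <-; rewrite lextU /bracket_basis.
rewrite addrC -scaleNr derP !der_Wd !derU.
rewrite !(partialM _ _ (@Lambda_par_basis _)) !mulrDr !mulrA -!scalerAr !mulrA.
rewrite (partialC d.2 c.2) mulrN (Lambda_mulC (@Lambda_par_basis d.1) (@Lambda_par_basis c.1)).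
rewrite -scalerAl scaleNr !scalerDr !scalerN !signZZ opprD opprK addrC.
set s := (-1) ^+ _ *: (_ * _ * partial c.2 u).
set t := (_ * partial c.2 _ * partial d.2 u).
rewrite -addrA; congr (_ + _).
rewrite addrCA -[LHS]addr0; congr (_ + _).
rewrite -scalerDl.
by case: (odd #|` c.1|) (odd #|` d.1|) => [] []; rewrite /= ?expr0 ?expr1 ?subrr ?addNr ?scale0r.
Qed.

End W.

Section LinearAlgebra.
Variables (K : fieldType) (V : lmodType K).

Definition subspace (S : V -> Prop) : Prop :=
  S 0 /\ forall (a : K) (u v : V), S u -> S v -> S (a *: u + v).

Definition span (S : V -> Prop) (v : V) : Prop :=
  forall T : V -> Prop, subspace T -> (forall u, S u -> T u) -> T v.

Definition fin_dim (S : V -> Prop) : Prop :=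
  exists s : seq V, forall v, S v <-> span (fun u => u \in s) v.

(* V is the direct sum of the subspaces G i. *)
Definition is_grading (I : eqType) (G : I -> V -> Prop) : Prop :=
  [/\ forall i, subspace (G i),
      forall v, exists (s : seq I) (f : I -> V),
        [/\ uniq s, forall i, G i (f i) & v = \sum_(i <- s) f i]
    & forall (s : seq I) (f : I -> V), uniq s -> (forall i, G i (f i)) ->
        \sum_(i <- s) f i = 0 -> forall i, i \in s -> f i = 0].

End LinearAlgebra.

Definition subalgebra_gen (K : fieldType) (S : W K -> Prop) (x : W K) : Prop :=
  forall T : W K -> Prop, subspace T ->
    (forall y z, T y -> T z -> T (bracket y z)) ->
    (forall y, S y -> T y) -> T x.

(* For s empty the generator is partial_j. *)
Definition t_sub (K : fieldType) (n : nat) : W K -> Prop :=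
  subalgebra_gen (fun x => exists (s : seq nat) (j : nat),
    [/\ all (leq n) s, (n <= j)%N & x = Wd (\prod_(i <- s) xi K i) j]).

Definition W_le (K : fieldType) (x : W K) : Prop :=
  exists y z : W K, [/\ W_deg (-1) y, W_deg 0 z & x = y + z].

(* bool stands for Z/2: false is even, true is odd. *)
Structure W_module (K : fieldType) := WModule {
  W_carrier :> lmodType K;
  parity : bool -> W_carrier -> Prop;
  act : W K -> W_carrier -> W_carrier;
  parity_grading : is_grading parity;
  act_linear_l : forall m, linear (act^~ m);
  act_linear_r : forall x, linear (act x);
  act_parity : forall p q x m,
    W_par p x -> parity q m -> parity (p (+) q) (act x m);
  act_bracket : forall p q x y m, W_par p x -> W_par q y ->
    act (bracket x y) m = act x (act y m) - (-1) ^+ (p && q) *: act y (act x m)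
}.
Arguments parity {K} M p m : rename.
Arguments act {K} M x m : rename.

Definition is_W_hom (K : fieldType) (N M : W_module K) (f : N -> M) : Prop :=
  [/\ linear f,
      forall p m, parity N p m -> parity M p (f m)
    & forall x m, f (act N x m) = act M x (f m)].

Section Categories.
Variables (K : fieldType) (M : W_module K).

Definition has_compatible_Z_grading : Prop :=
  exists G : int -> M -> Prop,
    [/\ is_grading G,
        forall i j x m, W_deg i x -> G j m -> G (i + j) (act M x m)
      & forall k m, G k m -> parity M (odd `|k|%N) m].

(* Integrability over W_deg 0, the copy of gl(infinity). *)
Definition integrable : Prop :=
  forall x m, W_deg 0 x ->
    fin_dim (span (fun v => exists2 i, (0 < i)%N & v = iter i (act M x) m)).

Definition Ann (m : M) (x : W K) : Prop := act M x m = 0.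

Definition in_T_W : Prop :=
  [/\ has_compatible_Z_grading,
      integrable
    & forall m, exists n, forall x, t_sub n x -> Ann m x].

Definition in_T_W_le : Prop :=
  [/\ has_compatible_Z_grading,
      integrable
    & forall m, exists n, forall x, t_sub n x -> W_le x -> Ann m x].

(* Simple object of the full subcategory of W K-modules satisfying C; a       *)
(* subobject is represented by an injective homomorphism from an object of C. *)
Definition simple_object (C : W_module K -> Prop) : Prop :=
  [/\ C M,
      exists m : M, m <> 0
    & forall (N : W_module K) (f : N -> M), C N -> is_W_hom f -> injective f ->
        (forall n : N, n = 0) \/ (forall m : M, exists n : N, f n = m)].

End Categories.

(* Main.v *)
Require Import Defs.
From mathcomp Require Import all_boot all_order all_algebra.
From mathcomp Require Import reals complex.
From HB Require Import structures.
From mathcomp Require Import finmap boolp.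
(* Imported again since the library of vector spaces rebinds span and free. *)
Import Defs.

Set Implicit Arguments.
Unset Strict Implicit.
Unset Printing Implicit Defensive.

Import GRing.Theory Order.TTheory Num.Theory.
Local Open Scope fset_scope.
Local Open Scope ring_scope.

(** Write g for the Lie superalgebra W K, d_i for the element partial_i, and
    t_n for its subalgebra on the indices >= n.  An object of T_W is an object
    of T_W^<=, and a subobject in T_W^<= of an object of T_W lies in T_W
    because annihilators are inherited along injections.  So the content is
    that a simple object M of T_W^<= satisfies the annihilation condition for
    all of t_n ([simple_T_W_le_T_W]).

    A homogeneous nonzero vector is killed by d_i for large i; applying, where
    they do not vanish, the finitely many remaining d_i, which anticommute and
    square to zero, yields a homogeneous v != 0 killed by every d_i
    ([exists_singular]).  Call such a vector singular.

    A singular w of degree e generates, under g^k for k >= 0 alone, a subspace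
    stable under all d_i, hence the submodule generated by w, which then lies
    in degrees >= e.  If M is simple, this submodule is M, so M vanishes below
    degree e ([simple_degree_ge]): two nonzero singular vectors always have the
    same degree.

    Now take n such that the part of t_n of degrees -1 and 0 kills v, and let
    P d_j in t_n with P a monomial of degree at least 2.  By induction on the
    degree of P, d_i (P d_j v) = [d_i, P d_j] v = d_i(P) d_j v = 0 for all i.
    So P d_j v is singular of degree greater than that of v, hence zero, and
    t_n v = 0 ([simple_singular_killed]).

    Finally a basis element b of g supercommutes with t_N as soon as N exceeds
    every index occurring in b.  So the vectors killed by some t_n form a
    submodule ([killed_above_act]); it contains v, hence it is M.

    Simplicity is used only through [simple_generated]: a subspace containing a
    nonzero homogeneous vector and stable under g is all of M.  The submodule
    generated by such a vector is graded, and is made into an object of T_W^<=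
    on a subtype of M. *)

(** * Subspaces and gradings *)

Section Subspaces.
Variables (K : fieldType) (V : lmodType K) (S : V -> Prop).
Hypothesis subS : subspace S.

Lemma subspaceZ a u : S u -> S (a *: u).
Proof. by move=> Su; rewrite -[a *: u]addr0; apply: subS.2 => //; exact: subS.1. Qed.

Lemma subspaceD u v : S u -> S v -> S (u + v).
Proof. by move=> Su Sv; rewrite -[u]scale1r; exact: subS.2. Qed.

Lemma subspaceB u v : S u -> S v -> S (u - v).
Proof. by move=> Su Sv; apply: subspaceD => //; rewrite -scaleN1r; exact: subspaceZ. Qed.

End Subspaces.

Lemma linear_sum_seq (K : fieldType) (U V : lmodType K) (f : U -> V) (J : Type)
    (r : seq J) (F : J -> U) :
  linear f -> f (\sum_(i <- r) F i) = \sum_(i <- r) f (F i).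
Proof.
move=> lf.
pose g : {linear U -> V} := HB.pack f (GRing.isLinear.Build K U V *:%R f lf).
exact: (raddf_sum g).
Qed.

Lemma linear_zero (K : fieldType) (U V : lmodType K) (f : U -> V) : linear f -> f 0 = 0.
Proof. by move=> lf; have := lf (-1) 0 0; rewrite scaler0 addr0 scaleN1r addNr. Qed.

Section Grading.
Variables (K : fieldType) (V : lmodType K) (I : eqType) (G : I -> V -> Prop).
Hypothesis Ggr : is_grading G.

(** A family of projections lets stability of a subspace under homogeneous
    components be expressed without choosing a decomposition each time. *)
Definition is_components (c : I -> V -> V) : Prop :=
  [/\ forall i, linear (c i),
      forall i v, G i (c i v),
      forall i j v, G i v -> c j v = if j == i then v else 0
    & forall v, exists2 s, uniq s & v = \sum_(i <- s) c i v].

Let decomposes (v : V) (f : I -> V) : Prop :=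
  (forall i, G i (f i)) /\
  exists s : seq I,
    [/\ uniq s, forall i, i \notin s -> f i = 0 & v = \sum_(i <- s) f i].

Lemma sum_extend (s t : seq I) (f : I -> V) : uniq s -> uniq t ->
  {subset s <= t} -> (forall i, i \notin s -> f i = 0) ->
  \sum_(i <- s) f i = \sum_(i <- t) f i.
Proof.
move=> us ut st f0; rewrite [RHS](bigID (mem s)) /= [X in _ + X]big1 // addr0.
rewrite -[RHS]big_filter; apply: perm_big; apply: uniq_perm => //.
  exact: filter_uniq.
by move=> i; rewrite mem_filter; case: (boolP (i \in s)) => //= /st ->.
Qed.

Lemma decomposes_linear a u v f g : decomposes u f -> decomposes v g ->
  decomposes (a *: u + v) (fun i => a *: f i + g i).
Proof.
have [subG _ _] := Ggr.
move=> [Gf [s [us f0 ->]]] [Gg [t [ut g0 ->]]]; split.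
  by move=> i; exact: (subG i).2.
exists (undup (s ++ t)); split; first exact: undup_uniq.
  move=> i; rewrite mem_undup mem_cat negb_or => /andP[/f0 -> /g0 ->].
  by rewrite scaler0 addr0.
have sub1 : {subset s <= undup (s ++ t)}.
  by move=> i si; rewrite mem_undup mem_cat si.
have sub2 : {subset t <= undup (s ++ t)}.
  by move=> i si; rewrite mem_undup mem_cat si orbT.
rewrite big_split /= -scaler_sumr.
by rewrite (sum_extend us (undup_uniq _) sub1 f0) (sum_extend ut (undup_uniq _) sub2 g0).
Qed.

Lemma decomposes_inj v f g : decomposes v f -> decomposes v g -> f =1 g.
Proof.
have [_ _ Gdir] := Ggr.
move=> vf vg i; have := decomposes_linear (-1) vf vg.
rewrite scaleN1r addNr => -[Gh [s [us h0 s0]]].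
have h i0 : - f i0 + g i0 = 0.
  rewrite -scaleN1r; case: (boolP (i0 \in s)) => [si|/h0 //].
  exact: (Gdir s _ us Gh (esym s0)).
by apply/eqP; rewrite eq_sym -subr_eq0 addrC h.
Qed.

Lemma grading_components : exists c, is_components c.
Proof.
have [subG Gsum _] := Ggr.
have dec v : exists f, decomposes v f.
  have [s [f [us Gf ->]]] := Gsum v.
  exists (fun i => if i \in s then f i else 0); split.
    by move=> i; case: ifP => // _; exact: (subG i).1.
  exists s; split=> // [i /negPf-> //|].
  by rewrite !big_seq; apply: eq_bigr => i ->.
have [c cP] := choice dec.
exists (fun i v => c v i); split.
- move=> i a u v.
  exact: (decomposes_inj (cP _) (decomposes_linear a (cP u) (cP v)) i).
- by move=> i v; have [] := cP v.
- move=> i j v Gv.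
  have vf : decomposes v (fun j => if j == i then v else 0).
    split=> [k|]; first by case: eqP => [->//|_]; exact: (subG k).1.
    exists [:: i]; split=> // [k|]; first by rewrite inE => /negPf->.
    by rewrite big_seq1 eqxx.
  exact: (decomposes_inj (cP v) vf).
- by move=> v; have [_ [s [us _ e]]] := cP v; exists s.
Qed.

(** A linear map that shifts degrees by a bijection intertwines the components:
    both sides are linear in v, so it suffices to compare them on homogeneous
    vectors. *)
Lemma component_shift c (s t : I -> I) (f : V -> V) : is_components c ->
  cancel s t -> cancel t s -> linear f -> (forall i v, G i v -> G (s i) (f v)) ->
  forall j v, c j (f v) = f (c (t j) v).
Proof.
move=> [cl cG cE cs] sK tK lf Gf j v; have [r _ ->] := cs v.
rewrite (linear_sum_seq _ _ lf) !(linear_sum_seq _ _ (cl _)) (linear_sum_seq _ _ lf).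
apply: eq_bigr => i _; rewrite (cE _ _ _ (Gf _ _ (cG i v))) (cE _ _ _ (cG i v)).
have -> : (t j == i) = (j == s i) by rewrite -(inj_eq (can_inj sK)) tK.
by case: eqP => // _; rewrite (linear_zero lf).
Qed.

End Grading.

(** * Brackets of basis elements *)

Section Brackets.
Variable K : fieldType.
Local Notation wb b := (basis K b : W K).

Lemma W_par_basis (b : {fset nat} * nat) : W_par (~~ odd #|` b.1|) (wb b).
Proof.
by move=> c; rewrite mem_supp coef_basis; case: (eqVneq c b) => [->//|_]; rewrite eqxx.
Qed.

Lemma W_deg_basis (b : {fset nat} * nat) : W_deg ((#|` b.1|)%:Z - 1) (wb b).
Proof.
by move=> c; rewrite mem_supp coef_basis; case: (eqVneq c b) => [->//|_]; rewrite eqxx.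
Qed.

Lemma Wd0 j : Wd (0 : Lambda K) j = 0.
Proof. exact: linear0. Qed.

Lemma WdZ a (P : Lambda K) j : Wd (a *: P) j = a *: Wd P j.
Proof. exact: linearZ. Qed.

Lemma Wd_basis A j : Wd (basis K A : Lambda K) j = wb (A, j).
Proof. exact: lextU. Qed.

Lemma bracketUU (c d : {fset nat} * nat) : bracket (wb c) (wb d) = bracket_basis K c d.
Proof. by rewrite /bracket !lextU. Qed.

(** Derivations in disjoint sets of variables supercommute. *)
Lemma bracket_basis_far (c d : {fset nat} * nat) : c.2 \notin d.1 -> d.2 \notin c.1 ->
  bracket_basis K c d = 0.
Proof.
move=> /negPf cd /negPf dc.
by rewrite /bracket_basis !partialU cd dc !mulr0 !Wd0 scaler0 subr0.
Qed.

(** [partial_i, P partial_j] = partial_i(P) partial_j: the other term of the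
    bracket differentiates the constant 1. *)
Lemma bracket_basis_partial i A j : bracket_basis K (fset0, i) (A, j) =
  if i \in A then (-1) ^+ sgn [fset i] A *: wb (A `\ i, j) else 0.
Proof.
rewrite /bracket_basis /= !partialU in_fset0 mulr0 Wd0 scaler0 subr0.
case: ifP => _; last by rewrite mulr0 Wd0.
by rewrite -scalerAr WdZ mulUU /mulmono fdisjoint0X sgn0l expr0 scale1r fset0U Wd_basis.
Qed.

End Brackets.

(** * The subalgebras of large index *)

Section SupportAbove.
Variables (K : fieldType) (n : nat).

Definition above (b : {fset nat} * nat) : bool := all (leq n) b.1 && (n <= b.2)%N.

Definition Lambda_above (u : Lambda K) : Prop :=
  forall A, A \in supp u -> all (leq n) A.

Definition W_above (x : W K) : Prop := forall b, b \in supp x -> above b.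

Lemma supp_subspace (B : choiceType) (p : pred B) :
  subspace (fun x : free K B => forall b, b \in supp x -> p b).
Proof.
split=> [b|a x y px py b]; first by rewrite mem_supp coef0 eqxx.
rewrite mem_supp coefD coefZ => nz.
case: (boolP (b \in supp x)) => [/px //|/coef_out bx].
by apply: py; rewrite mem_supp; move: nz; rewrite bx mulr0 add0r.
Qed.

Lemma supp_basis (B : choiceType) (b c : B) : c \in supp (basis K b) -> c = b.
Proof. by rewrite mem_supp coef_basis; case: (eqVneq c b) => // _; rewrite eqxx. Qed.

Let LS : subspace Lambda_above := supp_subspace (fun A : {fset nat} => all (leq n) A).
Let WS : subspace W_above := supp_subspace above.

Lemma Lambda_above_basis (A : {fset nat}) :
  all (leq n) A -> Lambda_above (basis K A : Lambda K).
Proof. by move=> h B /supp_basis ->. Qed.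

Lemma Lambda_aboveM u v : Lambda_above u -> Lambda_above v -> Lambda_above (u * v).
Proof.
move=> hu hv.
apply: (@Lambda_indS _ (fun u => Lambda_above (u * v)) u).
- by rewrite mul0r; exact: LS.1.
- by move=> a x y hx hy; rewrite mulrDl -scalerAl; exact: LS.2.
move=> A /hu hA.
apply: (@Lambda_indS _ (fun v => Lambda_above ((basis K A : Lambda K) * v)) v).
- by rewrite mulr0; exact: LS.1.
- by move=> a x y hx hy; rewrite mulrDr -scalerAr; exact: LS.2.
move=> B /hv hB; rewrite mulUU /mulmono; case: ifP => _; last exact: LS.1.
apply: (subspaceZ LS); apply: Lambda_above_basis.
by apply/allP => i; rewrite in_fsetU => /orP[/(allP hA)|/(allP hB)].
Qed.

Lemma Lambda_above_partial j (A : {fset nat}) : all (leq n) A ->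
  Lambda_above (partial j (basis K A : Lambda K)).
Proof.
move=> hA; rewrite partialU; case: ifP => _; last exact: LS.1.
apply: (subspaceZ LS); apply: Lambda_above_basis.
by apply/allP => i; rewrite in_fsetD1 => /andP[_ /(allP hA)].
Qed.

Lemma W_above_Wd u j : Lambda_above u -> (n <= j)%N -> W_above (Wd u j).
Proof.
move=> hu nj; apply: (@Lambda_indS _ (fun u => W_above (Wd u j)) u).
- by rewrite Wd0; exact: WS.1.
- by move=> a x y hx hy; rewrite WdP; exact: WS.2.
by move=> A /hu hA; rewrite Wd_basis => b /supp_basis ->; rewrite /above hA.
Qed.

Lemma W_above_bracket x y : W_above x -> W_above y -> W_above (bracket x y).
Proof.
move=> hx hy.
apply: (@W_indS _ (fun x => W_above (bracket x y)) x).
- by rewrite (_ : bracket 0 y = 0); [exact: WS.1 | exact: linear0].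
- move=> a u v hu hv.
  rewrite (_ : bracket _ y = a *: bracket u y + bracket v y); last exact: linearP.
  exact: WS.2.
move=> c /hx /andP[c1 c2].
rewrite (_ : bracket _ y = lext (bracket_basis K c) y); last exact: lextU.
apply: (@W_indS _ (fun y => W_above (lext (bracket_basis K c) y)) y).
- by rewrite linear0; exact: WS.1.
- by move=> a u v hu hv; rewrite linearP; exact: WS.2.
move=> d /hy /andP[d1 d2]; rewrite lextU.
apply: (subspaceB WS); last apply: (subspaceZ WS); apply: W_above_Wd => //;
  by apply: Lambda_aboveM; [exact: Lambda_above_basis | exact: Lambda_above_partial].
Qed.

(** The elements supported on indices >= n form a subspace closed under the
    bracket and contain the generators. *)
Lemma t_sub_above x : t_sub n x -> W_above x.
Proof.
apply; [exact: WS | exact: W_above_bracket |].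
move=> y [s [j [hs nj ->]]]; apply: W_above_Wd => //.
elim: s hs => [|i s IH] /=.
  by move=> _; rewrite big_nil; exact: (@Lambda_above_basis fset0).
move=> /andP[ni hs]; rewrite big_cons; apply: Lambda_aboveM; last exact: IH.
by apply: Lambda_above_basis; apply/allP => k; rewrite in_fset1 => /eqP ->.
Qed.

End SupportAbove.

(** * Graded submodules as objects *)

Section SubspaceType.
Variables (K : fieldType) (V : lmodType K) (S : V -> Prop).

(** The hypothesis is a parameter so that the vector space structure below can
    be found from the type alone. *)
Definition subspace_pred (hS : subspace S) : {pred V} := fun v => `[< S v >].

Variable hS : subspace S.

Lemma subspace_predP v : reflect (S v) (v \in subspace_pred hS).
Proof. exact: asboolP. Qed.

Lemma subspace_pred_closed : submod_closed (subspace_pred hS).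
Proof.
split; first by apply/subspace_predP; exact: hS.1.
move=> a u v /subspace_predP Su /subspace_predP Sv.
by apply/subspace_predP; exact: hS.2.
Qed.

HB.instance Definition _ :=
  GRing.isSubmodClosed.Build K V (subspace_pred hS) subspace_pred_closed.

Definition subspace_type : Type := {v : V | v \in subspace_pred hS}.
HB.instance Definition _ := SubType.on subspace_type.
HB.instance Definition _ := Choice.on subspace_type.
HB.instance Definition _ := [SubChoice_isSubLmodule of subspace_type by <:].

Lemma subspace_valP (v : subspace_type) : S (val v).
Proof. exact/subspace_predP/valP. Qed.

Lemma subspace_lift v : S v -> {u : subspace_type | val u = v}.
Proof. by move=> /subspace_predP Sv; exists (Sub v Sv); rewrite SubK. Qed.

Lemma subspace_vallinear : linear (val : subspace_type -> V).
Proof. by move=> a u v; rewrite linearP. Qed.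

End SubspaceType.

Lemma is_grading_restrict (K : fieldType) (V : lmodType K) (I : eqType)
    (G : I -> V -> Prop) (c : I -> V -> V) (S : V -> Prop) (hS : subspace S) :
  is_grading G -> is_components G c -> (forall i v, S v -> S (c i v)) ->
  is_grading (fun i (v : subspace_type hS) => G i (val v)).
Proof.
move=> [subG _ Gdir] [_ cG _ cs] Sc; split.
- move=> i; split=> [|a u v Gu Gv]; first by rewrite linear0; exact: (subG i).1.
  by rewrite subspace_vallinear; exact: (subG i).2.
- move=> v; have [s us vE] := cs (val v).
  pose f i := sval (subspace_lift hS (Sc i _ (subspace_valP v))).
  have fE i : val (f i) = c i (val v) by rewrite /f; case: subspace_lift.
  exists s, f; split=> // [i|]; first by rewrite fE.
  apply: val_inj; rewrite (linear_sum_seq _ _ (@subspace_vallinear _ _ _ hS)) [LHS]vE.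
  by apply: eq_bigr => i _; rewrite fE.
- move=> s f us Gf s0 i si; apply: val_inj; rewrite [RHS]linear0.
  apply: (Gdir s (fun i => val (f i)) us Gf) si.
  by rewrite -(linear_sum_seq _ _ (@subspace_vallinear _ _ _ hS)) s0 linear0.
Qed.

(** Both directions transport the test subspace of the definition of span, by
    image and by preimage. *)
Lemma span_image (K : fieldType) (U V : lmodType K) (f : U -> V) (X : U -> Prop) u :
  linear f -> injective f ->
  span (fun v => exists2 u, X u & v = f u) (f u) <-> span X u.
Proof.
move=> lf injf; split=> h T hT XT.
  have [|v [u' Xu' ->]|u' Tu' /injf -> //] :=
    h (fun v => exists2 u, T u & v = f u).
  - split=> [|a v w [v' Tv ->] [w' Tw ->]].
      by exists 0; [exact: hT.1 | rewrite linear_zero].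
    by exists (a *: v' + w'); [exact: hT.2 | rewrite lf].
  - by exists u' => //; exact: XT.
apply: (h (fun u => T (f u))); last by move=> v Xv; apply: XT; exists v.
split=> [|a v w Tv Tw]; first by rewrite linear_zero //; exact: hT.1.
by rewrite lf; exact: hT.2.
Qed.

Section SubWModule.
Variables (K : fieldType) (M : W_module K) (S : M -> Prop) (hS : subspace S).
Hypothesis actS : forall x m, S m -> S (act M x m).
Variable c : bool -> M -> M.
Hypothesis cP : is_components (parity M) c.
Hypothesis cS : forall p m, S m -> S (c p m).

Local Notation N := (subspace_type hS).

Definition sub_act (x : W K) (v : N) : N :=
  sval (subspace_lift hS (actS x (subspace_valP v))).

Lemma val_sub_act x v : val (sub_act x v) = act M x (val v).
Proof. by rewrite /sub_act; case: subspace_lift. Qed.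

Definition sub_parity (p : bool) (v : N) : Prop := parity M p (val v).

Lemma sub_act_linear_l v : linear (sub_act^~ v).
Proof.
move=> a x y; apply: val_inj.
by rewrite subspace_vallinear !val_sub_act act_linear_l.
Qed.

Lemma sub_act_linear_r x : linear (sub_act x).
Proof.
move=> a u v; apply: val_inj.
by rewrite !(val_sub_act, subspace_vallinear) act_linear_r.
Qed.

Lemma sub_act_parity p q x v :
  W_par p x -> sub_parity q v -> sub_parity (p (+) q) (sub_act x v).
Proof. by move=> px qv; rewrite /sub_parity val_sub_act; exact: act_parity. Qed.

Lemma sub_act_bracket p q x y v : W_par p x -> W_par q y ->
  sub_act (bracket x y) v =
    sub_act x (sub_act y v) - (-1) ^+ (p && q) *: sub_act y (sub_act x v).
Proof.
move=> px qy; apply: val_inj; rewrite addrC -scaleNr.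
rewrite subspace_vallinear !val_sub_act (act_bracket _ px qy) scaleNr addrC.
by [].
Qed.

Definition sub_W_module : W_module K :=
  WModule (is_grading_restrict hS (parity_grading M) cP cS)
    sub_act_linear_l sub_act_linear_r sub_act_parity sub_act_bracket.

Lemma sub_W_hom : @is_W_hom K sub_W_module M val.
Proof.
split=> [|p v|x v]; [exact: subspace_vallinear | by [] | exact: val_sub_act].
Qed.

(** A finite spanning set of an orbit span lies in the submodule, because the
    orbit does, so it lifts. *)
Lemma sub_integrable : integrable M -> integrable sub_W_module.
Proof.
move=> intM x v dx; have [s sP] := intM x (val v) dx.
have val_iter i : val (iter i (act sub_W_module x) v) = iter i (act M x) (val v).
  by elim: i => //= i <-; rewrite val_sub_act.
have Ss u : u \in s -> S u.
  move=> us; apply: ((sP u).2 _ S hS) => [T _|_ [i _ ->]]; first exact.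
  by rewrite -val_iter; exact: subspace_valP.
have [s' s'E] : exists s' : seq N, s = map val s'.
  elim: s Ss {sP} => [|u s IH] Ss; first by exists [::].
  have [|s' ->] := IH; first by move=> w ws; apply: Ss; rewrite inE ws orbT.
  have [u' <-] := subspace_lift hS (Ss u (mem_head _ _)).
  by exists (u' :: s').
exists s' => u.
have lv := @subspace_vallinear _ _ _ hS; have iv : injective (val : N -> M) := val_inj.
rewrite -(span_image _ _ lv iv) -[X in _ <-> X](span_image _ _ lv iv).
have -> : (fun w : M => exists2 u0 : N, u0 \in s' & w = val u0) = (fun w => w \in s).
  apply/funext => w; apply/propext; rewrite s'E.
  by split=> [[w' ws' ->]|/mapP[w' ws' ->]]; [exact: map_f | exists w'].
rewrite -sP.
set X := (fun w => exists2 _, _ & _); set Y := (fun w => exists2 _, _ & _).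
have -> // : X = Y.
apply/funext => w; apply/propext.
split=> [[_ [i i0 ->] ->]|[i i0 ->]]; first by exists i => //; rewrite val_iter.
by exists (iter i (act sub_W_module x) v); [exists i | rewrite val_iter].
Qed.

Lemma sub_T_W_le (G : int -> M -> Prop) (d : int -> M -> M) :
  is_grading G -> is_components G d -> (forall i m, S m -> S (d i m)) ->
  (forall i j x m, W_deg i x -> G j m -> G (i + j) (act M x m)) ->
  (forall k m, G k m -> parity M (odd `|k|%N) m) ->
  in_T_W_le M -> in_T_W_le sub_W_module.
Proof.
move=> Ggr dP dS Gact Gpar [_ intM annM]; split; last 1 first.
- move=> v; have [n nP] := annM (val v); exists n => x tx lx.
  by apply: val_inj; rewrite val_sub_act [RHS]linear0; exact: nP.
- exists (fun i (v : N) => G i (val v)); split.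
  + exact: is_grading_restrict Ggr dP dS.
  + by move=> i j x v dx Gv; rewrite val_sub_act; exact: Gact.
  + by move=> k v; exact: Gpar.
- exact: sub_integrable.
Qed.

End SubWModule.

(** * Generation in simple objects *)

Section Generated.
Variables (K : fieldType) (M : W_module K).
Local Notation wb b := (basis K b : W K).

Lemma act0l m : act M 0 m = 0.
Proof. exact: linear_zero (act_linear_l m). Qed.

Lemma act0r x : act M x 0 = 0.
Proof. exact: linear_zero (act_linear_r x). Qed.

Lemma actZl a x m : act M (a *: x) m = a *: act M x m.
Proof. by rewrite -[a *: x]addr0 act_linear_l act0l addr0. Qed.

Lemma act_basis_comm (b d : {fset nat} * nat) m :
  act M (wb b) (act M (wb d) m) = act M (bracket_basis K b d) m
    + (-1) ^+ (~~ odd #|` b.1| && ~~ odd #|` d.1|) *: act M (wb d) (act M (wb b) m).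
Proof.
by rewrite -bracketUU (act_bracket _ (@W_par_basis K b) (@W_par_basis K d)) subrK.
Qed.

Lemma act_stable (S : M -> Prop) : subspace S ->
  (forall b m, S m -> S (act M (wb b) m)) -> forall x m, S m -> S (act M x m).
Proof.
move=> hS Sb x m Sm; apply: (@W_indS _ (fun x => S (act M x m)) x).
- by rewrite act0l; exact: hS.1.
- by move=> a y z Sy Sz; rewrite act_linear_l; exact: hS.2.
- by move=> b _; exact: Sb.
Qed.

(** The condition on the monomials in the acting basis elements gives two
    notions at once: [predT] yields the submodule generated by w, and
    [predC1 fset0] the subspace obtained from w by elements of degree >= 0. *)
Definition generated (A : pred {fset nat}) (w m : M) : Prop :=
  forall P : M -> Prop, subspace P -> P w ->
    (forall b m, A b.1 -> P m -> P (act M (wb b) m)) -> P m.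

Lemma generated_subspace A w : subspace (generated A w).
Proof.
by split=> [P hP _ _|a u v gu gv P hP Pw Pb];
  [exact: hP.1 | apply: hP.2; [exact: gu P hP Pw Pb | exact: gv P hP Pw Pb]].
Qed.

Lemma generated_self A w : generated A w w. Proof. by []. Qed.

Lemma generated_act (A : pred {fset nat}) w b m :
  A b.1 -> generated A w m -> generated A w (act M (wb b) m).
Proof. by move=> Ab gm P hP Pw Pb; apply: (Pb _ _ Ab); exact: gm P hP Pw Pb. Qed.

(** Basis elements are homogeneous, so the closure of a homogeneous vector is a
    graded subspace.  This serves both the integer grading and the parity. *)
Lemma generated_component (I : eqType) (G : I -> M -> Prop) (c : I -> M -> M)
    (s t : {fset nat} * nat -> I -> I) A w k :
  is_components G c -> (forall b, cancel (s b) (t b)) ->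
  (forall b, cancel (t b) (s b)) ->
  (forall b i m, G i m -> G (s b i) (act M (wb b) m)) -> G k w ->
  forall j m, generated A w m -> generated A w (c j m).
Proof.
move=> cP sK tK Gs Gw j m gm; have [cl _ cE _] := cP.
have gS := @generated_subspace A w.
apply: (gm (fun m => forall j, generated A w (c j m))) j => [|j|b u Ab gu j].
- split=> [j|a u v gu gv j]; first by rewrite linear_zero //; exact: gS.1.
  by rewrite cl; exact: gS.2.
- by rewrite (cE _ _ _ Gw); case: eqP => _; [exact: generated_self | exact: gS.1].
- rewrite (component_shift cP (sK b) (tK b) (act_linear_r (wb b)) (Gs b)).
  exact: generated_act.
Qed.

Variables (G : int -> M -> Prop) (c : int -> M -> M).
Hypothesis Ggr : is_grading G.
Hypothesis cP : is_components G c.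
Hypothesis Gact : forall i j x m, W_deg i x -> G j m -> G (i + j) (act M x m).
Hypothesis Gpar : forall k m, G k m -> parity M (odd `|k|%N) m.

Lemma component_act b j m :
  c j (act M (wb b) m) = act M (wb b) (c (j - ((#|` b.1|)%:Z - 1)) m).
Proof.
apply: (component_shift (s := +%R ((#|` b.1|)%:Z - 1))
    (t := fun j => j - ((#|` b.1|)%:Z - 1)) cP).
- by move=> i; rewrite /= addrC addKr.
- by move=> i; rewrite /= addrC subrK.
- exact: act_linear_r.
- by move=> i v; apply: Gact; exact: W_deg_basis.
Qed.

(** The submodule generated by w is a nonzero object with an injection to M. *)
Lemma simple_generated w k : simple_object M (@in_T_W_le K) ->
  w <> 0 -> G k w -> forall m, generated predT w m.
Proof.
move=> [leM _ simpM] w0 Gw m.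
have gS := @generated_subspace predT w.
have gA : forall x u, generated predT w u -> generated predT w (act M x u).
  by apply: act_stable => // b u; exact: generated_act.
have [p pP] := grading_components (parity_grading M).
have gp : forall q u, generated predT w u -> generated predT w (p q u).
  apply: (generated_component (s := fun b q => ~~ odd #|` b.1| (+) q)
    (t := fun b q => ~~ odd #|` b.1| (+) q) pP) (Gpar Gw) => [b q|b q|b q u].
  - by rewrite addbA addbb.
  - by rewrite addbA addbb.
  - by apply: act_parity; exact: W_par_basis.
have gc : forall j u, generated predT w u -> generated predT w (c j u).
  apply: (generated_component (s := fun b => +%R ((#|` b.1|)%:Z - 1))
    (t := fun b j => j - ((#|` b.1|)%:Z - 1)) cP) Gw => [b q|b q|b q u].
  - by rewrite /= addrC addKr.
  - by rewrite /= addrC subrK.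
  - by apply: Gact; exact: W_deg_basis.
have leN := sub_T_W_le gS gA pP gp Ggr cP gc Gact Gpar leM.
have [all0|onto] := simpM _ _ leN (sub_W_hom gS gA pP gp) val_inj.
  have [w' w'E] := subspace_lift gS (@generated_self predT w).
  by case: w0; rewrite -w'E (all0 w') linear0.
by have [v <-] := onto m; exact: (subspace_valP v).
Qed.

Definition singular (m : M) : Prop := forall i, act M (wb (fset0, i)) m = 0.

(** Moving partial_i to the right past an element of degree k >= 0 leaves a
    bracket of degree k - 1, which is again one of the allowed elements or, for
    k = 0, some partial_j applied to a shorter word. *)
Lemma singular_generated_partial w i m : singular w ->
  generated (predC1 fset0) w m -> generated (predC1 fset0) w (act M (wb (fset0, i)) m).
Proof.
move=> sw gm; set g := generated (predC1 fset0) w.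
have gS : subspace g := @generated_subspace _ w.
suff [] : g m /\ forall i, g (act M (wb (fset0, i)) m) by [].
apply: (gm (fun m => g m /\ forall i, g (act M (wb (fset0, i)) m))).
- split=> [|a u v [gu du] [gv dv]].
    by split=> [|j]; rewrite ?act0r; exact: gS.1.
  by split=> [|j]; rewrite ?act_linear_r; exact: gS.2.
- by split=> [|j]; [exact: generated_self | rewrite sw; exact: gS.1].
move=> [A k] u nA [gu du]; split=> [|j]; first exact: generated_act nA gu.
rewrite act_basis_comm; apply: (subspaceD gS); last first.
  by apply: (subspaceZ gS); exact: generated_act nA (du j).
rewrite bracket_basis_partial; case: ifP => jA; last by rewrite act0l; exact: gS.1.
rewrite actZl; apply: (subspaceZ gS).
case: (eqVneq (A `\ j) fset0) => [->|nz]; first exact: du.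
by apply: generated_act => //; exact: gu.
Qed.

(** The elements of degree >= 0 already generate M from w, and they do not
    lower the degree. *)
Lemma simple_degree_ge w e d m : simple_object M (@in_T_W_le K) ->
  w <> 0 -> G e w -> singular w -> G d m -> d < e -> m = 0.
Proof.
move=> simpM w0 Gw sw Gm de.
have gS := @generated_subspace (predC1 fset0) w.
have gm : generated (predC1 fset0) w m.
  apply: (simple_generated simpM w0 Gw) => // -[A j] u _ gu.
  case: (eqVneq A fset0) => [->|nA]; first exact: singular_generated_partial.
  exact: generated_act.
have [cl _ cE _] := cP.
suff /(_ d de) : forall k, k < e -> c k m = 0 by rewrite (cE _ _ _ Gm) eqxx.
apply: (gm (fun m => forall k, k < e -> c k m = 0)) => [|k ke|b u nb cu k ke].
- split=> [k _|a u v hu hv k ke]; first by rewrite linear_zero.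
  by rewrite cl hu // hv // scaler0 addr0.
- by rewrite (cE _ _ _ Gw) lt_eqF.
- rewrite component_act cu ?act0r //; apply: le_lt_trans ke.
  by rewrite gerBl subr_ge0 lez_nat cardfs_gt0.
Qed.

(** * Annihilation by the subalgebras of large index *)

Definition killed_above (n : nat) (m : M) : Prop :=
  forall b, above n b -> act M (wb b) m = 0.

(** A basis element supercommutes with all basis elements whose indices exceed
    its own. *)
Lemma killed_above_act n b m : killed_above n m ->
  exists n', killed_above n' (act M (wb b) m).
Proof.
move=> hm; set N := maxn n (maxn (\max_(i <- b.1) i) b.2).+1.
have lt_i i : i \in b.1 -> (i < N)%N.
  by move=> ib; rewrite leq_max ltnS leq_max (@leq_bigmax_seq _ _ _ id) ?orbT.
have lt_b : (b.2 < N)%N by rewrite leq_max ltnS leq_maxr orbT.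
exists N => d /andP[d1 d2].
rewrite act_basis_comm hm ?act0r ?scaler0 ?addr0; last first.
  rewrite /above (leq_trans _ d2) ?leq_maxl // andbT; apply/allP => i /(allP d1).
  by apply: leq_trans; exact: leq_maxl.
rewrite bracket_basis_far ?act0l //.
  by apply/negP => /lt_i; rewrite ltnNge d2.
by apply/negP => /(allP d1); rewrite leqNgt lt_b.
Qed.

Lemma killed_above_le n n' m : (n <= n')%N -> killed_above n m -> killed_above n' m.
Proof.
move=> nn' hm b /andP[b1 b2]; apply: hm; rewrite /above (leq_trans nn' b2) andbT.
by apply/allP => i /(allP b1); exact: leq_trans.
Qed.

Lemma killed_above_subspace : subspace (fun m => exists n, killed_above n m).
Proof.
split=> [|a u v [n hu] [n' hv]]; first by exists 0%N => b _; rewrite act0r.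
exists (maxn n n') => b hb; rewrite act_linear_r.
rewrite (killed_above_le (leq_maxl n n') hu hb) (killed_above_le (leq_maxr n n') hv hb).
by rewrite scaler0 addr0.
Qed.

Lemma killed_above_Ann n m x : killed_above n m -> t_sub n x -> Ann m x.
Proof.
move=> hm /t_sub_above ax; apply: (@W_indS _ (fun x => act M x m = 0) x).
- exact: act0l.
- by move=> a y z hy hz; rewrite act_linear_l hy hz scaler0 addr0.
- by move=> b /ax; exact: hm.
Qed.

Lemma T_W_le_killed m : in_T_W_le M ->
  exists n, forall b, above n b -> (#|` b.1| <= 1)%N -> act M (wb b) m = 0.
Proof.
move=> [_ _ annM]; have [n nP] := annM m; exists n => -[A j] /andP[/= hA nj] A1.
apply: nP.
  move=> T hT Tbr; apply; exists A, j; split=> //.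
  rewrite -Wd_basis; congr Wd.
  have [|[i ->]] : A = fset0 \/ exists i, A = [fset i].
  - move: A1; rewrite leq_eqVlt ltnS leqn0 cardfs_eq0 => /orP[/cardfs1P[i ->]|/eqP ->].
      by right; exists i.
    by left.
  - by move=> ->; rewrite big_seq_fset0.
  by rewrite big_seq_fset1.
have deg0 k : W_deg k (0 : W K) by move=> b; rewrite mem_supp coef0 eqxx.
have := @W_deg_basis K (A, j); move: A1; rewrite /= leq_eqVlt ltnS leqn0.
case/orP => /eqP -> dA; first by exists 0, (wb (A, j)); rewrite add0r.
by exists (wb (A, j)), 0; rewrite addr0.
Qed.

Hypothesis two_neq0 : 2%:R != 0 :> K.

(** Descending on n, a vector killed by partial_i for i > n is replaced by its
    image under partial_n, unless that is zero. *)
Lemma exists_singular : in_T_W_le M -> (exists m : M, m <> 0) ->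
  exists (v : M) d, [/\ v <> 0, G d v & singular v].
Proof.
move=> leM [m m0]; have [_ cG cE cs] := cP.
have [k ck0] : exists k, c k m <> 0.
  apply: contrapT => h; apply: m0; have [s _ ->] := cs m.
  by rewrite big1 // => i _; apply: contrapT => ci; apply: h; exists i.
have [n nP] := T_W_le_killed (c k m) leM.
have : exists (v : M) d, [/\ v <> 0, G d v &
    forall i, (n <= i)%N -> act M (wb (fset0, i)) v = 0].
  exists (c k m), k; split=> // i ni.
  by apply: nP; rewrite ?cardfs0.
elim: n {nP} => [[v [d [v0 Gv hv]]]|n IH [v [d [v0 Gv hv]]]].
  by exists v, d; split=> // i; exact: hv.
have comm i j u : act M (wb (fset0, i)) (act M (wb (fset0, j)) u) =
    - act M (wb (fset0, j)) (act M (wb (fset0, i)) u).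
  rewrite act_basis_comm bracket_basis_partial in_fset0 act0l add0r /=.
  by rewrite expr1 scaleN1r.
apply: IH; case: (pselect (act M (wb (fset0, n)) v = 0)) => [nv|nv].
  exists v, d; split=> // i; rewrite leq_eqVlt => /orP[/eqP <- //|]; exact: hv.
exists (act M (wb (fset0, n)) v), ((#|` (fset0 : {fset nat})|)%:Z - 1 + d).
split=> // [|i]; first by apply: Gact => //; exact: W_deg_basis.
rewrite leq_eqVlt => /orP[/eqP <-|ni]; last by rewrite comm hv // act0r oppr0.
(* partial_n anticommutes with itself, so its square is its own opposite. *)
set u := act _ _ (act _ _ _).
have uN : u = - u by rewrite {1}/u comm.
have : 2%:R *: u = 0 by rewrite scaler_nat mulr2n {1}uN addNr.
by move/eqP; rewrite scaler_eq0 (negPf two_neq0) => /eqP.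
Qed.

(** For a monomial P of degree >= 2, the vector P partial_j v is singular by
    induction on the degree of P and its degree exceeds that of v; a nonzero
    such vector would force v = 0. *)
Lemma simple_singular_killed v d : simple_object M (@in_T_W_le K) ->
  v <> 0 -> G d v -> singular v -> exists n, killed_above n v.
Proof.
move=> simpM v0 Gv sv; have [leM _ _] := simpM.
have [n nP] := T_W_le_killed v leM; exists n => -[A j].
have [k] := ubnP #|` A|; elim: k => // k IH in A j * => Ak hb.
case: (leqP #|` A| 1) => [A1|A2]; first exact: nP.
apply: contrapT => w0; apply: v0.
apply: (simple_degree_ge simpM w0 (Gact (@W_deg_basis K _) Gv) _ Gv) => [i|].
  rewrite act_basis_comm sv act0r scaler0 addr0 bracket_basis_partial.
  case: ifP => [iA|_]; last exact: act0l.
  rewrite actZl IH ?scaler0 //.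
    by move: Ak; rewrite (cardfsD1 i A) iA.
  move: hb => /andP[hA nj]; rewrite /above nj andbT; apply/allP => a.
  by rewrite in_fsetD1 => /andP[_ /(allP hA)].
by rewrite ltrDr subr_gt0 ltz_nat.
Qed.

End Generated.

(** * Comparison of the two categories *)

Lemma T_W_T_W_le (K : fieldType) (M : W_module K) : in_T_W M -> in_T_W_le M.
Proof.
by move=> [gr int ann]; split=> // m; have [n nP] := ann m; exists n => x /nP.
Qed.

Lemma T_W_sub (K : fieldType) (M N : W_module K) (f : N -> M) :
  in_T_W M -> in_T_W_le N -> is_W_hom f -> injective f -> in_T_W N.
Proof.
move=> [_ _ ann] [gr int _] [lf _ fact] injf; split=> // v.
have [n nP] := ann (f v); exists n => x tx; apply: injf.
by rewrite fact (linear_zero lf); exact: nP.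
Qed.

(** The vectors killed by some subalgebra of large index form a submodule, and
    it contains a singular vector. *)
Lemma simple_T_W_le_T_W (K : fieldType) (M : W_module K) : 2%:R != 0 :> K ->
  simple_object M (@in_T_W_le K) -> in_T_W M.
Proof.
move=> two simpM; have [leM nzM _] := simpM; have [gr int _] := leM.
split=> // m; have [G [Ggr Gact Gpar]] := gr.
have [c cP] := grading_components Ggr.
have [v [d [v0 Gv sv]]] := exists_singular cP Gact two leM nzM.
have vk := simple_singular_killed Ggr cP Gact Gpar simpM v0 Gv sv.
have [n nP] : exists n, killed_above n m.
  have := simple_generated Ggr cP Gact Gpar simpM v0 Gv m.
  move=> /(_ (fun m => exists n, killed_above n m)); apply=> //.
    exact: killed_above_subspace.
  by move=> b u _ [n]; exact: killed_above_act.
by exists n => x; exact: killed_above_Ann.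
Qed.

Theorem corollary5p13 (R : realType) (M : W_module R[i]) :
  simple_object M (@in_T_W R[i]) <-> simple_object M (@in_T_W_le R[i]).
Proof.
split=> simpM.
  have [TM nz simp] := simpM; split=> //; first exact: T_W_T_W_le.
  by move=> N f leN hf injf; apply: (simp N f _ hf injf); exact: T_W_sub TM leN hf injf.
have [leM nz simp] := simpM; split=> //.
  by apply: simple_T_W_le_T_W simpM; rewrite pnatr_eq0.
by move=> N f /T_W_T_W_le; exact: simp.
Qed.
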